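(* The space of conjugation invariants in $T(\mathbb{R}^d)$ equals the image of $\operatorname{rot}$, i.e. the linear span of $\{\operatorname{rot}(w) : w \text{ a word}\}$. Equivalently, an element $\phi\in T(\mathbb{R}^d)$ is a conjugation invariant if and only if, for every $m\ge 0$, its homogeneous component $\pi_m\phi$ satisfies $\pi_m\phi=\operatorname{shift}_m(\pi_m\phi)$.
   Context: $T(\mathbb{R}^d)=\bigoplus_{n\ge0}T_n$, $T_n=(\mathbb{R}^d)^{\otimes n}$, has as basis the words $i_1\cdots i_n$ over the alphabet $\{1,\dots,d\}$ (a letter $i$ is identified with the basis vector $e_i$); $T((\mathbb{R}^d))=\prod_{n\ge0}T_n$. Both carry the concatenation product $xy$. The pairing $\langle \sum_w c_w w, v\rangle := c_v$ for words $v$ is extended bilinearly; $\pi_n$ denotes projection onto $T_n$. A path is a piecewise smooth map $X:[0,1]\to\mathbb{R}^d$. Its signature $S(X)\in T((\mathbb{R}^d))$ is defined recursively by $\langle S(X),\mathsf{e}\rangle=1$ (empty word) and $\langle S(X), w i\rangle=\int_0^1\langle S(X|_{[0,t]}),w\rangle\,dX^i(t)$ for any word $w$ and letter $i$; it is invariant under translation and reparametrization. $A\sqcup B$ denotes concatenation of paths (after translating $B$ to start at the endpoint of $A$), and $B^{-1}$ is the reversed path $t\mapsto B(1-t)$. An element $\phi\in T(\mathbb{R}^d)$ is a conjugation invariant if $\langle S(A),\phi\rangle=\langle S(B\sqcup A\sqcup B^{-1}),\phi\rangle$ for all paths $A,B$ (equivalently $\langle S(A\sqcup B),\phi\rangle=\langle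 S(B\sqcup A),\phi\rangle$ for all $A,B$). For a word $w$, $\operatorname{rot}(w)$ is the sum of its $|w|$ cyclic rotations (counted with multiplicity, e.g. $\operatorname{rot}(11)=2\cdot 11$, $\operatorname{rot}(12)=12+21$). $\operatorname{shift}_m$ is the linear map on $T_m$ sending a word $w_1\cdots w_m$ to $w_m w_1\cdots w_{m-1}$.
   Formalization: For the empty word, rot is taken to be the empty word itself rather than the empty sum 0; otherwise the constant 1 would be a conjugation invariant outside the span. ''Piecewise smooth'' is read as piecewise continuously differentiable. *)

(* Defs.v *)
From Stdlib Require Import Reals.
From Coquelicot Require Import Coquelicot.
From mathcomp Require Import all_boot all_algebra.
From mathcomp Require Import Rstruct.

Set Implicit Arguments.
Unset Strict Implicit.
Unset Printing Implicit Defensive.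

Import GRing.Theory.
Local Open Scope ring_scope.

(* A path in R^d: a map t |-> X t, with X t i the i-th coordinate.
   Only the values on [0,1] are relevant. *)
Definition path (d : nat) := R -> 'I_d -> R.

Definition piecewise_smooth (d : nat) (X : path d) : Prop :=
  exists (ts : seq R),
    [/\ head 0%R ts = 0%R, last 0%R ts = 1%R,
        sorted (fun a b : R => a < b) ts &
        forall j : nat, (j.+1 < size ts)%N ->
          forall i : 'I_d, exists g : R -> R,
            (forall t, ex_derive g t /\ continuous (Derive g) t) /\
            (forall t : R, nth 0%R ts j <= t <= nth 0%R ts j.+1 -> X t i = g t)].

(* Concatenation A ⊔ B (B translated to start at the end of A),
   parametrized on [0,1]. *)
Definition concat_path (d : nat) (A B : path d) : path d :=
  fun t i => if t <= (1/2)%R then A (2 * t)%R i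
             else (B (2 * t - 1)%R i - B 0%R i + A 1%R i)%R.

Definition rev_path (d : nat) (B : path d) : path d :=
  fun t i => B (1 - t)%R i.

(* sig_rev X v t = <S(X|_[0,t]), rev v>, defined by the recursion
   <S, w i> = \int_0^t <S(X|_[0,s]), w> dX^i(s),  dX^i(s) = X^i'(s) ds. *)
Fixpoint sig_rev (d : nat) (X : path d) (v : seq 'I_d) (t : R) : R :=
  match v with
  | [::] => 1%R
  | i :: v' => RInt (fun s => (sig_rev X v' s * Derive (fun u => X u i) s)%R) 0%R t
  end.

Definition sig (d : nat) (X : path d) (w : seq 'I_d) : R := sig_rev X (rev w) 1%R.

(* An element of T(R^d): a coefficient for every word, vanishing on words
   longer than some degree bound (finite support). *)
Record tensor (d : nat) := Tensor {
  coef : seq 'I_d -> R;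
  deg : nat;
  coefP : forall w : seq 'I_d, (deg < size w)%N -> coef w = 0
}.

Definition pairing (d : nat) (X : path d) (phi : tensor d) : R :=
  \sum_(n < (deg phi).+1) \sum_(t : n.-tuple 'I_d) coef phi t * sig X t.

Definition conjugation_invariant (d : nat) (phi : tensor d) : Prop :=
  forall A B : path d, piecewise_smooth A -> piecewise_smooth B ->
    pairing A phi = pairing (concat_path (concat_path B A) (rev_path B)) phi.

(* Coefficient of the word w in rot(v): the number of cyclic rotations of v
   equal to w (the |v| rotations rot 0 v, ..., rot (|v|-1) v); for the empty
   word we use the convention rot(e) = e. *)
Definition rot_coef (d : nat) (v w : seq 'I_d) : R :=
  (count (fun k => rot k v == w) (iota 0 (maxn 1 (size v))))%:R.

Definition in_rot_span (d : nat) (phi : tensor d) : Prop :=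
  exists s : seq (R * seq 'I_d),
    forall w, coef phi w = \sum_(p <- s) p.1 * rot_coef p.2 w.

Definition shift_word (d : nat) (w : seq 'I_d) : seq 'I_d := rotr 1 w.

Definition shift_pi_coef (d : nat) (m : nat) (phi : tensor d) (w' : seq 'I_d) : R :=
  \sum_(t : m.-tuple 'I_d) coef phi t * (shift_word t == w')%:R.

Definition shift_invariant (d : nat) (phi : tensor d) : Prop :=
  forall (m : nat) (w : seq 'I_d), size w = m -> coef phi w = shift_pi_coef m phi w.

(* Main.v *)
Require Import Defs.
From Stdlib Require Import Reals.
From mathcomp Require Import all_boot all_algebra.
From Stdlib Require Import Lra Factorial FunctionalExtensionality.
From Coquelicot Require Import Coquelicot.
From mathcomp Require Import all_order Rstruct.

(** By Chen's identity the signature of A ⊔ B is the convolution S(A) S(B), and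
    S(B) S(B^{-1}) = 1.  Hence conjugation invariance of phi means
    <S(A) S(B), phi> = <S(B) S(A), phi>, which a rotation-invariant phi satisfies
    because cutting a word at k and rotating it by k swaps the two factors.
    Conversely, the axis paths t |-> k t e_i, k = 0, ..., N, have signatures
    exp(k e_i); inverting a Vandermonde matrix, a linear combination of these is
    e_i modulo words longer than N = deg phi.  Products of such combinations are
    again combinations of signatures of (concatenated) paths, so
    <x u, phi> = <u x, phi> for each letter x and word u of length < N: the
    coefficients of phi are invariant under rotation. *)

Set Implicit Arguments.
Unset Strict Implicit.
Unset Printing Implicit Defensive.

Import Order.TTheory GRing.Theory Num.Theory.
Local Open Scope ring_scope.
Delimit Scope R_scope with coqR.

(** * Convolution of functions on words *)

Section Convolution.
Variables (T : Type) (K : comNzRingType).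
Implicit Types (f g h : seq T -> K) (w : seq T).

(** The concatenation product of two series given by their coefficients: the sum of [f u * g v] over
    all cuts [w = u ++ v]. The recursion on [w] lets inductions vary [f]. *)
Fixpoint conv f g w : K :=
  f [::] * g w + (if w is x :: w' then conv (fun u => f (x :: u)) g w' else 0).

Lemma conv_cons f g x w :
  conv f g (x :: w) = f [::] * g (x :: w) + conv (fun u => f (x :: u)) g w.
Proof. by []. Qed.

Lemma conv_nil f g : conv f g [::] = f [::] * g [::].
Proof. exact: addr0. Qed.

(** A cut of [w] yields factors no longer than [w], so products respect truncation at length [n]. *)
Lemma eq_conv f f' g g' n :
    (forall w, (size w <= n)%N -> f w = f' w) ->
    (forall w, (size w <= n)%N -> g w = g' w) ->
  forall w, (size w <= n)%N -> conv f g w = conv f' g' w.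
Proof.
move=> + eqg w; elim: w n f f' eqg => [|x w IHw] n f f' eqg eqf le_w_n.
  by rewrite !conv_nil eqf ?eqg.
rewrite !conv_cons eqf // eqg //; congr (_ + _).
apply: (IHw n.-1).
- by move=> u le_u; apply: eqg; apply: leq_trans le_u (leq_pred _).
- by move=> u le_u; apply: eqf; rewrite /= -(ltn_predK le_w_n).
- by rewrite -ltnS (ltn_predK le_w_n).
Qed.

Lemma convDl f1 f2 g w : conv (fun u => f1 u + f2 u) g w = conv f1 g w + conv f2 g w.
Proof.
elim: w f1 f2 => [|x w IHw] f1 f2; first by rewrite !conv_nil mulrDl.
by rewrite !conv_cons IHw mulrDl addrACA.
Qed.

Lemma convZl a f g w : conv (fun u => a * f u) g w = a * conv f g w.
Proof.
elim: w f => [|x w IHw] f; first by rewrite !conv_nil mulrA.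
by rewrite !conv_cons IHw mulrDr mulrA.
Qed.

Lemma convDr f g1 g2 w : conv f (fun u => g1 u + g2 u) w = conv f g1 w + conv f g2 w.
Proof.
elim: w f => [|x w IHw] f; first by rewrite !conv_nil mulrDr.
by rewrite !conv_cons IHw mulrDr addrACA.
Qed.

Lemma convZr a f g w : conv f (fun u => a * g u) w = a * conv f g w.
Proof.
elim: w f => [|x w IHw] f; first by rewrite !conv_nil mulrCA.
by rewrite !conv_cons IHw mulrDr mulrCA.
Qed.

Lemma conv0l g w : conv (fun=> 0) g w = 0.
Proof.
elim: w => [|x w IHw]; first by rewrite conv_nil mul0r.
by rewrite conv_cons IHw mul0r addr0.
Qed.

Lemma conv0r f w : conv f (fun=> 0) w = 0.
Proof.
elim: w f => [|x w IHw] f; first by rewrite conv_nil mulr0.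
by rewrite conv_cons IHw mulr0 addr0.
Qed.

Lemma convA f g h w : conv f (conv g h) w = conv (conv f g) h w.
Proof.
elim: w f => [|x w IHw] f; first by rewrite !conv_nil mulrA.
rewrite !conv_cons conv_nil (convDl (fun u => f [::] * g (x :: u))) convZl IHw.
by rewrite mulrDr mulrA addrA.
Qed.

Lemma conv_rcons f g w x :
  conv f g (rcons w x) = conv f (fun u => g (rcons u x)) w + f (rcons w x) * g [::].
Proof.
elim: w f => [|y w IHw] f; first by rewrite conv_cons !conv_nil.
by rewrite rcons_cons !conv_cons IHw addrA.
Qed.

(** Reversal of words is an anti-automorphism; it enters because [sig_rev] reads words from the last
    letter. *)
Lemma conv_rev f g w :
  conv f g (rev w) = conv (fun u => g (rev u)) (fun u => f (rev u)) w.
Proof.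
elim: w g => [|x w IHw] g; first by rewrite !conv_nil mulrC.
rewrite rev_cons conv_rcons IHw conv_cons addrC mulrC rev_cons; congr (_ + _).
by apply: (@eq_conv _ _ _ _ (size w)) => // u _; rewrite rev_cons.
Qed.

Lemma conv_sum f g w :
  conv f g w = \sum_(k < (size w).+1) f (take k w) * g (drop k w).
Proof.
elim: w f => [|x w IHw] f; first by rewrite big_ord1 conv_nil.
by rewrite conv_cons IHw [RHS]big_ord_recl.
Qed.

End Convolution.

(** * Chen's identity and the signature of the reversed path *)

Section Analysis.
Local Open Scope R_scope.

Lemma is_RInt_zero_off_point (f : R -> R) c a b : a <= b ->
  (forall x, x <> c -> f x = 0) -> is_RInt f a b 0.
Proof.
move=> le_ab f0.
have zero u v : u <= v -> (v <= c \/ c <= u) -> is_RInt f u v 0.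
  move=> le_uv cuv; apply: (is_RInt_ext (fun _ => 0)).
    move=> x; rewrite Rmin_left // Rmax_right // => xuv; rewrite f0 //; lra.
  have := is_RInt_const u v (0 : R).
  by rewrite /scal /= /mult /= Rmult_0_r.
case: (Rle_dec c a) => ca; first by apply: zero; auto.
case: (Rle_dec b c) => bc; first by apply: zero; auto.
rewrite -(Rplus_0_r 0); apply: (is_RInt_Chasles _ _ c); apply: zero; lra.
Qed.

(** By induction on [E]: a correction supported at one point has integral zero, so the points are
    removed one by one. *)
Lemma is_RInt_ext_finite (E : list R) (f g : R -> R) a b l : a <= b ->
  (forall x, a < x < b -> ~ List.In x E -> f x = g x) ->
  is_RInt f a b l -> is_RInt g a b l.
Proof.
move=> le_ab; elim: E f => [|c E IHE] f fg If.
  apply: is_RInt_ext If => x; rewrite Rmin_left // Rmax_right // => xab.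
  exact: fg.
pose e x := if Req_EM_T x c then g x - f x else 0.
apply: (IHE (fun x => f x + e x)).
  move=> x xab nE; rewrite /e; case: (Req_EM_T x c) => [?|xc] /=; first by ring.
  rewrite fg //; first by ring.
  by case=> // cx; apply: xc.
rewrite -(Rplus_0_r l); apply: (is_RInt_plus f e) => //.
apply: (is_RInt_zero_off_point (c := c)) => // x xc.
by rewrite /e; case: (Req_EM_T x c) => //=.
Qed.

Lemma RInt_ext_finite (E : list R) (f g : R -> R) a b : a <= b -> ex_RInt f a b ->
  (forall x, a < x < b -> ~ List.In x E -> f x = g x) ->
  RInt g a b = RInt f a b.
Proof.
move=> le_ab exf fg; apply: is_RInt_unique.
apply: (@is_RInt_ext_finite E f) => //; exact: RInt_correct.
Qed.

Variable d : nat.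
Implicit Types (X A B : Defs.path d) (D DA DB : 'I_d -> R -> R) (v : seq 'I_d).

(* Testing against all continuous h passes to iterated integrals, which are
   continuous, without keeping track of the smooth pieces. *)
Definition integrable_velocity D := forall i (h : R -> R) a b,
  (forall t, continuous h t) -> ex_RInt (fun s => h s * D i s) a b.

(* Finitely many exceptional times: there Derive returns junk values, which do not
   transform under reparametrization. *)
Definition has_velocity X D := exists E : list R, forall i s,
  0 < s < 1 -> ~ List.In s E -> is_derive (fun u => X u i) s (D i s).

(** The recursion of [sig_rev] with a prescribed velocity in place of [Derive], so that
    reparametrizing a path becomes a substitution in integrals. *)
Fixpoint iter_int D v (t : R) : R :=
  if v is i :: v' then RInt (fun s => iter_int D v' s * D i s) 0 t else 1.

Lemma iter_int_continuous D v : integrable_velocity D ->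
  forall t, continuous (iter_int D v) t.
Proof.
move=> iD; elim: v => [|i v IHv] t /=; first exact: continuous_const.
apply: (continuous_RInt_1 (fun s => iter_int D v s * D i s) 0 t).
by apply: filter_forall => z; apply: RInt_correct; apply: iD.
Qed.

Lemma iter_int_integrable D v i a b : integrable_velocity D ->
  ex_RInt (fun s => iter_int D v s * D i s) a b.
Proof. by move=> iD; apply: (iD) => t; apply: iter_int_continuous. Qed.

(** By induction on the word, the integrands agree off a finite set of times, which the integral
    does not see. *)
Lemma sig_rev_iter_int X D v t : integrable_velocity D -> has_velocity X D ->
  0 <= t <= 1 -> sig_rev X v t = iter_int D v t.
Proof.
move=> iD [E XD]; elim: v t => [|i v IHv] t t01 //.
change (RInt (fun s => sig_rev X v s * Derive (fun u => X u i) s) 0 t =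
        RInt (fun s => iter_int D v s * D i s) 0 t).
apply: (@RInt_ext_finite E); [lra | exact: iter_int_integrable |] => x xt nE.
rewrite IHv; last lra.
by rewrite (is_derive_unique _ _ _ (XD i x _ nE)) //; lra.
Qed.

(** * Velocities of concatenated and reversed paths *)

Definition concat_velocity DA DB : 'I_d -> R -> R := fun i s =>
  if Rle_dec s (1/2) then 2 * DA i (2 * s) else 2 * DB i (2 * s - 1).

Definition rev_velocity D : 'I_d -> R -> R := fun i s => - D i (1 - s).

Lemma ex_RInt_affine (f : R -> R) u c a b :
  ex_RInt f (u * a + c) (u * b + c) -> ex_RInt (fun y => u * f (u * y + c)) a b.
Proof. exact: (@ex_RInt_comp_lin R_NormedModule). Qed.

Lemma RInt_affine (f : R -> R) u c a b :
  ex_RInt f (u * a + c) (u * b + c) ->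
  RInt (fun y => u * f (u * y + c)) a b = RInt f (u * a + c) (u * b + c).
Proof. exact: (@RInt_comp_lin R_CompleteNormedModule). Qed.

Lemma continuous_affine (h : R -> R) u c : (forall t, continuous h t) ->
  forall t, continuous (fun t => h (u * t + c)) t.
Proof.
move=> ch t; apply: (continuous_comp (fun t => u * t + c)) => //.
apply: (@continuous_plus _ R_AbsRing R_NormedModule); last exact: continuous_const.
apply: (@continuous_mult _ R_AbsRing); [exact: continuous_const | exact: continuous_id].
Qed.

Lemma concat_velocity_integrable DA DB :
  integrable_velocity DA -> integrable_velocity DB ->
  integrable_velocity (concat_velocity DA DB).
Proof.
move=> iA iB i h a b ch.
(* Every integral is routed through the junction time 1/2. *)
suff half z : ex_RInt (fun s => h s * concat_velocity DA DB i s) (1/2) z.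
  by apply: (ex_RInt_Chasles _ _ (1/2)); first apply: ex_RInt_swap.
(* Composing [h] with the inverse substitution makes the whole integrand a function of
   [u * s + k]. *)
have affine u k D x y : integrable_velocity D -> u <> 0 ->
    ex_RInt (fun s => u * (h s * D i (u * s + k))) x y.
  move=> iD u0; apply: (ex_RInt_ext (fun s => u * (h (/u * (u * s + k) + (- (k / u)))
      * D i (u * s + k)))).
    by move=> s _; do 3 f_equal; field.
  apply: (@ex_RInt_affine (fun s => h (/u * s + - (k / u)) * D i s)).
  by apply: iD; apply: continuous_affine.
case: (Rle_dec z (1/2)) => z2.
  apply: (ex_RInt_ext (fun s => 2 * (h s * DA i (2 * s + 0)))); last by apply: affine => //; lra.
  move=> s; rewrite Rmin_right // Rmax_left // /concat_velocity => sz.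
  case: Rle_dec => [?|] /=; last lra.
  by rewrite Rplus_0_r; ring.
apply: (ex_RInt_ext (fun s => 2 * (h s * DB i (2 * s + (-1))))); last by apply: affine => //; lra.
have le2z : 1/2 <= z by lra.
move=> s; rewrite Rmin_left // Rmax_right // /concat_velocity => sz.
case: Rle_dec => [|?] /=; first lra.
have -> : 2 * s - 1 = 2 * s + -1 by ring.
by ring.
Qed.

Lemma rev_velocity_integrable D :
  integrable_velocity D -> integrable_velocity (rev_velocity D).
Proof.
move=> iD i h a b ch.
apply: (ex_RInt_ext (fun s => -1 * (h (-1 * (-1 * s + 1) + 1) * D i (-1 * s + 1)))).
  move=> s _; rewrite /rev_velocity.
  have -> : -1 * (-1 * s + 1) + 1 = s by ring.
  have -> : -1 * s + 1 = 1 - s by ring.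
  by rewrite /=; ring.
apply: (@ex_RInt_affine (fun s => h (-1 * s + 1) * D i s)).
by apply: iD; apply: continuous_affine.
Qed.

Lemma is_derive_affine (f : R -> R) u c s l : is_derive f (u * s + c) l ->
  is_derive (fun t => f (u * t + c)) s (u * l).
Proof.
move=> df; apply: (is_derive_comp f (fun t => u * t + c)) => //.
by auto_derive => //; ring.
Qed.

Lemma halfE : ((1 / 2)%R : R) = / 2.
Proof. by rewrite mul1r. Qed.

Lemma concat_pathE A B t i :
  concat_path A B t i =
  if Rle_dec t (1/2) then A (2 * t) i else B (2 * t - 1) i - B 0 i + A 1 i.
Proof.
rewrite /concat_path; case: Rle_dec => h /=.
  by case: RleP => // -[]; rewrite halfE; lra.
by case: RleP => // h'; case: h; move: h'; rewrite halfE; lra.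
Qed.

(** At the junction both formulas give [A 1 i], so the second one holds on the closed half. *)
Lemma concat_path_right A B t i : 1/2 <= t ->
  concat_path A B t i = B (2 * t - 1) i - B 0 i + A 1 i.
Proof.
move=> t2; rewrite concat_pathE; case: Rle_dec => //= h.
have -> : t = 1/2 by lra.
have -> : 2 * (1/2) = 1 by field.
by rewrite Rminus_diag; ring.
Qed.

Lemma concat_has_velocity A B DA DB : has_velocity A DA -> has_velocity B DB ->
  has_velocity (concat_path A B) (concat_velocity DA DB).
Proof.
move=> [EA vA] [EB vB].
(* The exceptional times are the junction and the rescaled exceptional times of both paths. *)
exists (List.app (List.cons (1/2) (List.map (fun s => s / 2) EA))
             (List.map (fun s => (s + 1) / 2) EB)).
move=> i s s01 nE.
have sN : s <> 1/2 by move=> s2; apply: nE; rewrite s2; apply/List.in_app_iff; left; left.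
rewrite /concat_velocity; case: Rle_dec => s2 /=.
  have lt_s2 : s < 1/2 by lra.
  apply: (is_derive_ext_loc (fun u => A (2 * u + 0) i)).
    apply: filter_imp (open_lt (1/2) s lt_s2) => u u2.
    by rewrite concat_pathE Rplus_0_r; case: Rle_dec => ? /=; lra.
  apply: (is_derive_affine (f := fun u => A u i)); rewrite Rplus_0_r.
  apply: vA; first lra.
  move=> inE; apply: nE; apply/List.in_app_iff; left; right.
  by apply/List.in_map_iff; exists (2 * s); split => //; field.
have lt_s2 : 1/2 < s by lra.
apply: (is_derive_ext_loc (fun u => B (2 * u + (-1)) i + (A 1 i - B 0 i))).
  apply: filter_imp (open_gt (1/2) s lt_s2) => u u2.
  rewrite concat_path_right; last lra.
  have -> : 2 * u - 1 = 2 * u + -1 by ring.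
  by rewrite /=; ring.
rewrite -(Rplus_0_r (2 * _)).
apply: (is_derive_plus (fun u => B (2 * u + -1) i)); last exact: is_derive_const.
apply: (is_derive_affine (f := fun u => B u i)).
apply: vB; first lra.
move=> inE; apply: nE; apply/List.in_app_iff; right.
by apply/List.in_map_iff; exists (2 * s - 1); split => //; field.
Qed.

Lemma rev_has_velocity X D : has_velocity X D ->
  has_velocity (Defs.rev_path X) (rev_velocity D).
Proof.
move=> [E vX]; exists (List.map (fun s => 1 - s) E) => i s s01 nE.
apply: (is_derive_ext (fun u => X (-1 * u + 1) i)).
  move=> u; rewrite /Defs.rev_path; f_equal.
  by rewrite -RminusE -R1E; ring.
rewrite /rev_velocity.
have -> : - D i (1 - s) = -1 * D i (1 - s) by ring.
apply: (is_derive_affine (f := fun u => X u i)).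
have -> : -1 * s + 1 = 1 - s by ring.
apply: vX; first lra.
move=> inE; apply: nE; apply/List.in_map_iff; exists (1 - s); split => //; ring.
Qed.

(** * Iterated integrals along a concatenation *)

Lemma iter_int_concat_left DA DB v t : integrable_velocity DA ->
  t <= 1/2 -> iter_int (concat_velocity DA DB) v t = iter_int DA v (2 * t).
Proof.
move=> iA; elim: v t => [|i v IHv] t t2 //=.
have max2 : Rmax 0 t <= 1/2 by apply: Rmax_lub; lra.
rewrite (RInt_ext _ (fun s => 2 * (iter_int DA v (2 * s + 0) * DA i (2 * s + 0)))).
  rewrite (@RInt_affine (fun s => iter_int DA v s * DA i s)).
    by rewrite Rmult_0_r !Rplus_0_r.
  exact: iter_int_integrable.
move=> s st; rewrite IHv /concat_velocity ?Rplus_0_r; last lra.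
by case: Rle_dec => ? /=; [ring | lra].
Qed.

(** Time [t] of the second path is time [(t + 1) / 2] of the concatenation: the outer integral is
    split at 1/2 and its second part pulled back to the time of the second path. *)
Lemma iter_int_concat_right DA DB i v t :
  integrable_velocity DA -> integrable_velocity DB -> 0 <= t ->
  iter_int (concat_velocity DA DB) (i :: v) ((t + 1) / 2) =
  iter_int DA (i :: v) 1 +
  RInt (fun s => iter_int (concat_velocity DA DB) v ((s + 1) / 2) * DB i s) 0 t.
Proof.
move=> iA iB t0; set DC := concat_velocity DA DB.
have iC : integrable_velocity DC by apply: concat_velocity_integrable.
pose f s := iter_int DC v ((s + 1) / 2) * DB i s.
have exf : ex_RInt f 0 t.
  apply: iB => s.
  apply: (continuous_ext (fun s => iter_int DC v (/2 * s + /2))).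
    by move=> u; f_equal; field.
  by apply: continuous_affine => u; apply: iter_int_continuous.
have -> : iter_int DA (i :: v) 1 = iter_int DC (i :: v) (1/2).
  rewrite iter_int_concat_left //; last lra.
  by f_equal; field.
have fE : RInt f 0 t = RInt (fun s => iter_int DC v s * DC i s) (1/2) ((t + 1) / 2).
  have e0 : 2 * (1/2) + -1 = 0 by field.
  have et : 2 * ((t + 1) / 2) + -1 = t by field.
  rewrite -[in LHS]e0 -{1}et -RInt_affine ?e0 ?et //.
  apply: RInt_ext => s; rewrite Rmin_left ?Rmax_right; try lra; move=> st.
  rewrite /f /DC /concat_velocity; case: Rle_dec => ? /=; first lra.
  have -> : (2 * s + -1 + 1) / 2 = s by field.
  have -> : 2 * s - 1 = 2 * s + -1 by ring.
  by ring.
rewrite -/(f) fE /=; symmetry.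
by apply: (@RInt_Chasles R_CompleteNormedModule); apply: iter_int_integrable.
Qed.

(** At a fixed word the convolution is a finite linear combination of values of [g], so the integral
    passes inside. Existence is carried along because additivity of [RInt] requires it. *)
Lemma RInt_conv (g : seq 'I_d -> R -> R) (f : seq 'I_d -> R) (b : R -> R) x y v :
  (forall w, ex_RInt (fun s => g w s * b s) x y) ->
  let c s := conv (g^~ s) f v * b s in
  ex_RInt c x y /\ RInt c x y = conv (fun w => RInt (fun s => g w s * b s) x y) f v.
Proof.
elim: v g => [|i v IHv] g exg c.
  have e s : c s = scal (f [::]) (g [::] s * b s).
    by rewrite /c conv_nil /scal /= /mult /= -!RmultE; ring.
  split.
    by apply: ex_RInt_ext (fun s _ => esym (e s)) _; apply: ex_RInt_scal.
  rewrite (RInt_ext _ _ _ _ (fun s _ => e s)) RInt_scal // conv_nil.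
  by rewrite /scal /= /mult /= -RmultE; ring.
have [exI eI] := IHv (fun w => g (i :: w)) (fun w => exg (i :: w)).
have e s : c s = plus (scal (f (i :: v)) (g [::] s * b s))
                   (conv (fun w => g (i :: w) s) f v * b s).
  rewrite /c conv_cons /scal /plus /= /mult /= -!RmultE -RplusE; ring.
have ex1 : ex_RInt (fun s => scal (f (i :: v)) (g [::] s * b s)) x y.
  exact: ex_RInt_scal.
split.
  by apply: ex_RInt_ext (fun s _ => esym (e s)) _; apply: ex_RInt_plus.
rewrite (RInt_ext _ _ _ _ (fun s _ => e s)) RInt_plus // RInt_scal // eI conv_cons.
by rewrite /scal /plus /= /mult /= -RmultE -RplusE; ring.
Qed.

(** Chen's identity for an initial part of the second path. Words are reversed here, so head letters
    are integrated last, along the second path; hence its factor comes first. The case in which no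
    letter falls there is the boundary term at 1/2. *)
Lemma iter_int_chen DA DB v t :
  integrable_velocity DA -> integrable_velocity DB -> 0 <= t ->
  iter_int (concat_velocity DA DB) v ((t + 1) / 2) =
  conv (iter_int DB ^~ t) (iter_int DA ^~ 1) v.
Proof.
move=> iA iB; elim: v t => [|i v IHv] t t0.
  by rewrite conv_nil /= mul1r.
rewrite iter_int_concat_right // conv_cons /= mul1r; congr (_ + _).
have [_ <-] := @RInt_conv (iter_int DB) (iter_int DA ^~ 1) (DB i) 0 t v
  (fun w => iter_int_integrable w i 0 t iB).
apply: RInt_ext => s; rewrite Rmin_left // => st.
by rewrite IHv; last lra.
Qed.

(* Traversing a path and then part of its reverse has the signature of the untraversed
   initial part of X. *)
Lemma iter_int_backtrack D v t : integrable_velocity D -> 0 <= t ->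
  iter_int (concat_velocity D (rev_velocity D)) v ((t + 1) / 2) = iter_int D v (1 - t).
Proof.
move=> iD; have iR := rev_velocity_integrable iD.
elim: v t => [|i v IHv] t t0 //.
rewrite iter_int_concat_right //=.
pose f s := iter_int D v s * D i s.
set DC := concat_velocity _ _ in IHv *.
(* The substitution [s -> 1 - s] turns the return leg into an integral from 1 to [1 - t], which
   joins the one from 0 to 1. *)
rewrite (RInt_ext (fun s => iter_int DC v ((s + 1) / 2) * rev_velocity D i s)
  (fun s => -1 * f (-1 * s + 1))).
  rewrite RInt_affine; last exact: iter_int_integrable.
  have -> : -1 * 0 + 1 = 1 by ring.
  have -> : -1 * t + 1 = 1 - t by ring.
  by apply: (@RInt_Chasles R_CompleteNormedModule); apply: iter_int_integrable.
move=> s; rewrite Rmin_left // => st; rewrite IHv; last lra.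
rewrite /f /rev_velocity.
have -> : -1 * s + 1 = 1 - s by ring.
by rewrite /=; ring.
Qed.

End Analysis.

(** * Signatures of concatenated and reversed paths *)

Section Signature.
Variable d : nat.
Implicit Types (X A B : Defs.path d) (v w : seq 'I_d).

(** A working class rather than the usual notion of finite length: it contains the piecewise smooth
    paths, is stable under concatenation and reversal, and lets signatures be computed as
    [iter_int]. *)
Definition rectifiable X := exists D, integrable_velocity D /\ has_velocity X D.

Lemma rectifiable_concat A B :
  rectifiable A -> rectifiable B -> rectifiable (concat_path A B).
Proof.
move=> [DA [iA vA]] [DB [iB vB]]; exists (concat_velocity DA DB); split.
  exact: concat_velocity_integrable.
exact: concat_has_velocity.
Qed.

Lemma rectifiable_rev X : rectifiable X -> rectifiable (Defs.rev_path X).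
Proof.
move=> [D [iD vX]]; exists (rev_velocity D); split.
  exact: rev_velocity_integrable.
exact: rev_has_velocity.
Qed.

(** This is [iter_int_chen] at [t = 1]; [conv_rev] undoes the reversal and restores the order of the
    factors. *)
Lemma sig_concat A B w : rectifiable A -> rectifiable B ->
  sig (concat_path A B) w = conv (sig A) (sig B) w.
Proof.
move=> [DA [iA vA]] [DB [iB vB]].
have iC := concat_velocity_integrable iA iB.
have vC := concat_has_velocity vA vB.
have unit1 : (0 <= 1 <= 1)%coqR by lra.
rewrite /sig (sig_rev_iter_int _ iC vC unit1).
have e : (1 = (1 + 1) / 2 :> R)%coqR by field.
rewrite [X in iter_int _ _ X]e iter_int_chen //; last lra.
rewrite conv_rev; apply: (@eq_conv _ _ _ _ _ _ (size w)) => // u _.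
  by rewrite (sig_rev_iter_int _ iA vA unit1).
by rewrite (sig_rev_iter_int _ iB vB unit1).
Qed.

(** Once the return is complete, [iter_int_backtrack] leaves iterated integrals over [[0, 0]], which
    vanish except on the empty word. *)
Lemma conv_sig_rev X w : rectifiable X ->
  conv (sig X) (sig (Defs.rev_path X)) w = (w == [::])%:R.
Proof.
move=> rX; rewrite -sig_concat //; last exact: rectifiable_rev.
have [D [iD vX]] := rX.
have iC := concat_velocity_integrable iD (rev_velocity_integrable iD).
have vC := concat_has_velocity vX (rev_has_velocity vX).
have unit1 : (0 <= 1 <= 1)%coqR by lra.
rewrite /sig (sig_rev_iter_int _ iC vC unit1).
have e : (1 = (1 + 1) / 2 :> R)%coqR by field.
rewrite [X in iter_int _ _ X]e iter_int_backtrack //; last lra.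
rewrite Rminus_diag; case: (lastP w) => [|u x] //.
rewrite rev_rcons -size_eq0 size_rcons /=; exact: RInt_point.
Qed.

Lemma rev_pathK X : Defs.rev_path (Defs.rev_path X) = X.
Proof.
apply: functional_extensionality => t; rewrite /Defs.rev_path.
by rewrite subKr.
Qed.

End Signature.

(** * Piecewise smooth paths *)

Section Smooth.
Local Open Scope R_scope.
Variable d : nat.
Implicit Types (X A B : Defs.path d).

Definition smooth_piece X a b := forall i, exists g : R -> R,
  (forall t, ex_derive g t /\ continuous (Derive g) t) /\
  (forall t, a <= t <= b -> X t i = g t).

Definition smooth_pieces X (ts : seq R) := forall j, (j.+1 < size ts)%N ->
  smooth_piece X (nth 0%R ts j) (nth 0%R ts j.+1).

Lemma piecewise_smoothP X : piecewise_smooth X <-> exists ts : seq R,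
  [/\ path.path <%O 0 ts, last 0 ts = 1 & smooth_pieces X (0 :: ts)].
Proof.
split=> [[[|a ts] [/= a0 l1 lt_ts pX]]|[ts [lt_ts l1 pX]]].
(* An empty subdivision would have [last] equal to its default 0, not 1. *)
- by case: R1_neq_R0; rewrite [RHS]l1.
- rewrite a0 in lt_ts l1 pX; exists ts; split=> // j ltj i.
  have [g [dg Xg]] := pX j ltj i; exists g; split=> // t tj; apply: Xg.
  by apply/andP; split; apply/RleP; case: tj.
exists (0 :: ts); split=> // j ltj i.
have [g [dg Xg]] := pX j ltj i; exists g; split=> // t /andP[/RleP t1 /RleP t2].
by apply: Xg.
Qed.

(** In the interior of a piece, [X] coincides near each time with the C^1 function [g], so its
    derivative there is the continuous derivative of [g]. *)
Lemma smooth_piece_integrable X a b i (h : R -> R) : a <= b ->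
  (forall t, continuous h t) -> smooth_piece X a b ->
  ex_RInt (fun s => h s * Derive (fun u => X u i) s) a b /\
  forall t, a < t < b -> ex_derive (fun u => X u i) t.
Proof.
move=> le_ab ch /(_ i) [g [dg Xg]].
have loc s : a < s < b -> locally s (fun u => g u = X u i).
  move=> [as_ sb].
  apply: filter_imp (filter_and _ _ (open_gt a s as_) (open_lt b s sb)) => u [ua ub].
  by rewrite Xg; lra.
split=> [|t tab]; last by apply: ex_derive_ext_loc (loc t tab) _; case: (dg t).
apply: (ex_RInt_ext (fun s => h s * Derive g s)).
  move=> s; rewrite Rmin_left // Rmax_right // => sab.
  by rewrite (Derive_ext_loc _ _ _ (loc s sab)).
apply: ex_RInt_continuous => z _.
by apply: (@continuous_mult _ R_AbsRing) => //; case: (dg z).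
Qed.

Lemma smooth_pieces_integrable X (a : R) (ts : seq R) i (h : R -> R) :
  path.path <%O a ts -> (forall t, continuous h t) -> smooth_pieces X (a :: ts) ->
  [/\ a <= last a ts, ex_RInt (fun s => h s * Derive (fun u => X u i) s) a (last a ts) &
      forall t, a < t < last a ts -> ~ List.In t ts -> ex_derive (fun u => X u i) t].
Proof.
move=> + ch; elim: ts a => [|b ts IHts] a /=.
  move=> _ _; split; [lra | exact: ex_RInt_point | move=> t; lra].
case/andP=> /RltP lt_ab lt_ts pX.
have [|le_bl exb db] := IHts b lt_ts; first by move=> j; apply: (pX j.+1).
have [exa da] := smooth_piece_integrable i (Rlt_le _ _ lt_ab) ch (pX 0%N isT).
split; [lra | exact: ex_RInt_Chasles exa exb | move=> t tal tE].
have tb : t <> b by move=> tb; apply: tE; left.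
case: (Rlt_dec t b) => t_b; first by apply: da; lra.
by apply: db => [|?]; [lra | apply: tE; right].
Qed.

(** A path is arbitrary outside [[0, 1]], whereas [integrable_velocity] asks for integrability on
    every interval; cutting off the derivative bridges the gap. *)
Lemma integrable_truncate (f : R -> R) a b : ex_RInt f 0 1 ->
  ex_RInt (fun s => if Rlt_dec 0 s then if Rlt_dec s 1 then f s else 0 else 0) a b.
Proof.
move=> exf; set F := fun s => _.
have zero u v : u <= v -> v <= 0 \/ 1 <= u -> ex_RInt F u v.
  move=> le_uv uv; apply: (ex_RInt_ext (fun=> 0)); last exact: ex_RInt_const.
  move=> s; rewrite Rmin_left // Rmax_right // /F => s_uv.
  by case: Rlt_dec => ? //=; case: Rlt_dec => //= ?; lra.
have ex01 : ex_RInt F 0 1.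
  apply: ex_RInt_ext exf => s; rewrite Rmin_left ?Rmax_right; try lra; move=> s01.
  by rewrite /F; case: Rlt_dec => ? /=; [case: Rlt_dec => ? //= |]; lra.
suff ex0 z : ex_RInt F 0 z by apply: ex_RInt_Chasles (ex0 b); apply: ex_RInt_swap.
case: (Rle_dec z 0) => z0; first by apply/ex_RInt_swap/zero; lra.
case: (Rle_dec z 1) => z1; first by apply: (ex_RInt_Chasles_1 _ _ _ 1) => //; lra.
by apply: ex_RInt_Chasles ex01 _; apply: zero; lra.
Qed.

Lemma piecewise_smooth_rectifiable X : piecewise_smooth X -> rectifiable X.
Proof.
move/piecewise_smoothP => [ts [lt_ts l1 pX]].
exists (fun i s => if Rlt_dec 0 s then if Rlt_dec s 1 then
   Derive (fun u => X u i) s else 0 else 0); split.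
  move=> i h a b ch.
  have [_ exX _] := smooth_pieces_integrable i lt_ts ch pX; rewrite l1 in exX.
  apply: ex_RInt_ext (integrable_truncate a b exX) => s _.
  by do 2 (case: Rlt_dec => ? /=; rewrite ?Rmult_0_r //).
exists ts => i s s01 nE.
case: Rlt_dec => ? /=; last lra.
case: Rlt_dec => ? /=; last lra.
apply: Derive_correct.
have [_ _ dX] := smooth_pieces_integrable i lt_ts (fun t => continuous_const 0 t) pX.
by apply: dX => //; rewrite l1.
Qed.

Lemma path_lt_bounds (a : R) (ts : seq R) j : path.path <%O a ts -> (j < size (a :: ts))%N ->
  a <= nth 0%R (a :: ts) j <= last a ts.
Proof.
elim: ts a j => [|b ts IHts] a [|j] //=; try by move=> *; lra.
- by case/andP=> /RltP ab lt_ts _; have := IHts b 0%N lt_ts isT; lra.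
- case/andP=> /RltP ab lt_ts ltj; have [le1 le2] := IHts b j lt_ts ltj.
  by split=> //; apply: Rle_trans le1; apply: Rlt_le.
Qed.

Lemma smooth_piece_affine X Y u c (e : 'I_d -> R) a b :
  (forall t, a <= t <= b -> forall i, Y t i = X (u * t + c) i + e i) -> 0 < u ->
  smooth_piece X (u * a + c) (u * b + c) -> smooth_piece Y a b.
Proof.
move=> YX u0 pX i; have [g [dg Xg]] := pX i.
have dG t : is_derive (fun t => g (u * t + c) + e i) t (u * Derive g (u * t + c)).
  rewrite -(Rplus_0_r (u * _)).
  apply: (is_derive_plus (fun t => g (u * t + c))); last exact: is_derive_const.
  by apply: is_derive_affine; apply: Derive_correct; case: (dg (u * t + c)).
exists (fun t => g (u * t + c) + e i); split=> [t|t tab].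
  split; first by exists (u * Derive g (u * t + c)).
  apply: (continuous_ext (fun t => u * Derive g (u * t + c))).
    by move=> s; rewrite (is_derive_unique _ _ _ (dG s)).
  apply: (@continuous_mult _ R_AbsRing); first exact: continuous_const.
  by apply: (continuous_affine (h := Derive g)) => s; case: (dg s).
rewrite YX // Xg //.
by case: tab => ta tb; split; apply: Rplus_le_compat_r; apply: Rmult_le_compat_l; lra.
Qed.

Lemma piecewise_smooth_concat A B :
  piecewise_smooth A -> piecewise_smooth B -> piecewise_smooth (concat_path A B).
Proof.
move=> /piecewise_smoothP[sA [ltA lA pA]] /piecewise_smoothP[sB [ltB lB pB]].
(* [f] and [g] carry the breakpoints of [A] and [B] into the two halves of [[0, 1]]; the initial 0
   of [B] is dropped because [g 0 = f 1]. *)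
pose f t := t / 2; pose g t := (t + 1) / 2.
have f0 : f 0 = 0 by rewrite /f; field.
have fg : f 1 = g 0 by rewrite /f /g; field.
have ltf : {homo f : x y / (x < y)%O} by move=> x y /RltP xy; apply/RltP; rewrite /f; lra.
have ltg : {homo g : x y / (x < y)%O} by move=> x y /RltP xy; apply/RltP; rewrite /g; lra.
apply/piecewise_smoothP; exists (map f sA ++ map g sB); split.
- rewrite cat_path -{1 2}f0 last_map lA fg.
  by rewrite (homo_path ltf) // (homo_path ltg).
- by rewrite last_cat -f0 last_map lA fg last_map lB /g; field.
have -> : 0 :: map f sA ++ map g sB = map f (0 :: sA) ++ map g sB by rewrite /= f0.
move=> j; rewrite size_cat size_map => ltj.
have [ltjA|leAj] := ltnP j.+1 (size (0 :: sA)).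
  rewrite !nth_cat size_map ltjA (ltnW ltjA) !(nth_map 0%R) //; last exact: ltnW.
  have [_ le1] := path_lt_bounds ltA ltjA.
  apply: (@smooth_piece_affine A _ 2 0 (fun=> 0)); last 1 first.
  - have -> x : 2 * f x + 0 = x by rewrite /f; field.
    have -> x : 2 * f x + 0 = x by rewrite /f; field.
    exact: pA.
  - move=> t [_ tj] i; rewrite concat_pathE !Rplus_0_r; case: Rle_dec => //= nt.
    by case: nt; move: tj le1; rewrite lA /f; lra.
  - lra.
(* Index [size sA] is shared: its entry [f 1 = g 0] also stands for the initial breakpoint of
   [B]. *)
have nthB k : (size sA <= k)%N -> (k - size sA < (size sB).+1)%N ->
    nth 0%R (map f (0 :: sA) ++ map g sB) k = g (nth 0%R (0 :: sB) (k - size sA)).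
  rewrite nth_cat size_map => leAk ltk; case: ltnP => [ltk'|lek].
    have -> : k = size sA by apply/eqP; rewrite eqn_leq leAk andbT -ltnS.
    rewrite subnn (nth_map 0%R) //.
    by rewrite -last_nth lA fg.
  rewrite /= in lek *.
  by rewrite -(subnSK lek) /= (nth_map 0%R) // -ltnS subnSK.
rewrite /= size_map addSn !ltnS in ltj leAj.
have ltjB : (j - size sA < size sB)%N by rewrite -(ltn_add2r (size sA)) subnK // addnC.
have [ge0 _] := @path_lt_bounds 0 sB _ ltB (leqW ltjB).
rewrite !nthB ?(leqW leAj) ?subSn // ?ltnS; last exact: ltnW.
apply: (@smooth_piece_affine B _ 2 (-1) (fun i => A 1 i - B 0 i)); last 1 first.
- have gK x : 2 * g x + -1 = x by rewrite /g; field.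
  by rewrite !gK; apply: pB.
- move=> t [tj _] i; rewrite concat_path_right; last by move: tj; rewrite /g; lra.
  by rewrite /Rminus Rplus_assoc [(- B _ _ + _)]Rplus_comm.
- lra.
Qed.

(** * Axis paths and their signatures *)

Definition axis_path (i : 'I_d) (c : R) : Defs.path d :=
  fun t j => if j == i then c * t else 0.

Lemma axis_path_is_derive i c j t :
  is_derive (fun u => axis_path i c u j) t (if j == i then c else 0).
Proof.
rewrite /axis_path; case: eqP => _; last exact: is_derive_const.
by auto_derive => //; ring.
Qed.

Lemma piecewise_smooth_axis i c : piecewise_smooth (axis_path i c).
Proof.
apply/piecewise_smoothP; exists [:: 1]; split=> //=.
  by rewrite andbT; apply/RltP; lra.
move=> k _ j; exists (fun t => axis_path i c t j); split=> // t; split.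
  by eexists; apply: axis_path_is_derive.
apply: (continuous_ext (fun=> if j == i then c else 0)); last exact: continuous_const.
by move=> s; rewrite (is_derive_unique _ _ _ (axis_path_is_derive i c j s)).
Qed.

(** These are the coefficients of [exp(c t e_i)]: only powers of the letter [i] contribute. *)
Lemma sig_rev_axis i c v t : sig_rev (axis_path i c) v t =
  (if all (pred1 i) v then (c * t) ^ size v / INR (fact (size v)) else 0).
Proof.
elim: v t => [|j v IHv] t; first by rewrite /= Rdiv_1_r.
change (RInt (fun s => sig_rev (axis_path i c) v s *
   Derive (fun u => axis_path i c u j) s) 0 t =
   (if (j == i) && all (pred1 i) v
    then (c * t) ^ (size v).+1 / INR (fact (size v).+1) else 0)).
set n := size v in IHv *.
have fact0 m : INR (fact m) <> 0 by apply: INR_fact_neq_0.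
have Sn0 : INR n.+1 <> 0 by apply: not_0_INR.
rewrite (RInt_ext _ (fun s => (if (j == i) && all (pred1 i) v
    then (c * s) ^ n / INR (fact n) * c else 0))); last first.
  move=> s _; rewrite IHv (is_derive_unique _ _ _ (axis_path_is_derive i c j s)).
  by case: eqP; case: all => //= _; ring.
case: ifP => _; last by rewrite RInt_const /scal /= /mult /=; ring.
apply: is_RInt_unique.
have -> : (c * t) ^ n.+1 / INR (fact n.+1) =
  minus ((c * t) ^ n.+1 / INR (fact n.+1)) ((c * 0) ^ n.+1 / INR (fact n.+1)).
  by rewrite /minus /plus /opp /= Rmult_0_r Rmult_0_l /Rdiv Rmult_0_l; ring.
apply: (is_RInt_derive (fun s => (c * s) ^ n.+1 / INR (fact n.+1))) => s _.
  auto_derive => //.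
  rewrite -[(fact n + _)%coq_nat]/(n.+1 * fact n)%coq_nat mult_INR.
  rewrite -[match n with 0%N => 1 | _ => _ end]/(INR n.+1).
  by field; split.
apply: (@continuous_mult _ R_AbsRing); last exact: continuous_const.
apply: (@ex_derive_continuous R_AbsRing R_NormedModule).
by auto_derive.
Qed.
End Smooth.

Lemma sig_axis d (i : 'I_d) (c : R) w : sig (axis_path i c) w =
  c ^+ size w / ((size w)`!)%:R * (all (pred1 i) w)%:R.
Proof.
rewrite /sig sig_rev_axis all_rev size_rev; case: all; last by rewrite mulr0.
rewrite !mulr1 -factE -INRE -RpowE -RdivE; congr Rdiv; congr pow.
exact: mulr1.
Qed.

(** * Rotation invariance *)

Section Pairing.
Variables (d : nat) (phi : tensor d).
Implicit Types (f g : seq 'I_d -> R) (u v w : seq 'I_d).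

(** The pairing extended from signatures to arbitrary series, so that combinations and products can
    be paired; [pairing X phi] is [ev (sig X)] by definition. *)
Definition ev f : R :=
  \sum_(n < (deg phi).+1) \sum_(t : n.-tuple 'I_d) coef phi t * f t.

(** The pivot: conjugation invariance, membership in the span and shift invariance are each shown
    equivalent to it. *)
Definition rot_invariant := forall w, coef phi (rot 1 w) = coef phi w.

Lemma eq_ev f g : (forall w, (size w <= deg phi)%N -> f w = g w) -> ev f = ev g.
Proof.
move=> fg; apply: eq_bigr => n _; apply: eq_bigr => t _.
by rewrite fg // size_tuple -ltnS.
Qed.

Lemma evD f g : ev (fun w => f w + g w) = ev f + ev g.
Proof.
rewrite /ev -big_split; apply: eq_bigr => n _; rewrite -big_split.
by apply: eq_bigr => t _; rewrite mulrDr.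
Qed.

Lemma evZ a f : ev (fun w => a * f w) = a * ev f.
Proof.
rewrite /ev mulr_sumr; apply: eq_bigr => n _; rewrite mulr_sumr.
by apply: eq_bigr => t _; rewrite mulrCA.
Qed.

Lemma sum_tuple_pred1 n (F : seq 'I_d -> R) u :
  \sum_(t : n.-tuple 'I_d) F t * (tval t == u)%:R = F u * (size u == n)%:R.
Proof.
have [<-|neq] := eqVneq (size u) n.
  rewrite (bigD1 (in_tuple u)) //= eqxx big1 ?addr0 // => t.
  by rewrite -val_eqE /= => /negPf->; rewrite mulr0.
rewrite mulr0 big1 // => t _; case: eqP => [tu|_]; last by rewrite mulr0.
by rewrite -tu size_tuple eqxx in neq.
Qed.

Lemma sum_tuple_rot n k (F : seq 'I_d -> R) :
  \sum_(t : n.-tuple 'I_d) F (rot k t) = \sum_(t : n.-tuple 'I_d) F t.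
Proof.
rewrite [RHS](reindex_inj (h := fun t : n.-tuple 'I_d => [tuple of rot k t])) //.
by move=> t1 t2 /(congr1 val)/rot_inj/val_inj.
Qed.

Lemma coef_rot k w : rot_invariant -> coef phi (rot k w) = coef phi w.
Proof.
move=> inv; have [lt_wk|le_kw] := ltnP (size w) k; first by rewrite rot_oversize // ltnW.
by elim: k le_kw => [|k IHk] le_kw; rewrite ?rot0 // rotS // inv IHk // ltnW.
Qed.

Lemma ev_convC f g : rot_invariant -> ev (conv f g) = ev (conv g f).
Proof.
move=> inv; apply: eq_bigr => n _.
have expand f' g' (t : n.-tuple 'I_d) : coef phi t * conv f' g' t =
    \sum_(k < n.+1) coef phi t * (f' (take k t) * g' (drop k t)).
  rewrite conv_sum mulr_sumr -(big_mkord xpredT (fun k => coef phi t *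
    (f' (take k t) * g' (drop k t)))).
  by rewrite size_tuple big_mkord.
under eq_bigr do rewrite expand.
under [RHS]eq_bigr do rewrite expand.
(* Cuts at [k] are matched with cuts at [n - k]: rotating by [k] moves the suffix [drop k t] to the
   front, so the latter cut exchanges the two factors. *)
rewrite exchange_big [RHS]exchange_big /= [RHS](reindex_inj rev_ord_inj) /=.
apply: eq_bigr => k _; rewrite subSS.
rewrite -(@sum_tuple_rot _ k (fun u => coef phi u *
  (g (take (n - k) u) * f (drop (n - k) u)))).
apply: eq_bigr => t _; rewrite coef_rot // /rot.
have sd : size (drop k t) = (n - k)%N by rewrite size_drop size_tuple.
by rewrite take_size_cat // drop_size_cat // [g _ * _]mulrC.
Qed.

(** * Basis words as indicator functions *)

Definition delta u w : R := (w == u)%:R.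

Lemma conv_delta_nil g w : conv (delta [::]) g w = g w.
Proof.
case: w => [|x w]; first by rewrite conv_nil mul1r.
by rewrite conv_cons mul1r [conv _ _ _]conv0l addr0.
Qed.

Lemma conv_delta u v w : conv (delta u) (delta v) w = delta (u ++ v) w.
Proof.
elim: u w => [|x u IHu] w; first exact: conv_delta_nil.
case: w => [|y w]; first by rewrite conv_nil mul0r.
rewrite conv_cons mul0r add0r.
rewrite [RHS](_ : _ = (y == x)%:R * delta (u ++ v) w); last first.
  by rewrite /delta eqseq_cons -natrM mulnb.
rewrite -IHu -convZl; apply: (@eq_conv _ _ _ _ _ _ (size w)) => // z _.
by rewrite /delta eqseq_cons -natrM mulnb.
Qed.

Lemma conv_nil_delta f w : conv f (delta [::]) w = f w.
Proof.
elim: w f => [|x w IHw] f; first by rewrite conv_nil mulr1.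
by rewrite conv_cons mulr0 add0r IHw.
Qed.

Lemma ev_delta u : (size u <= deg phi)%N -> ev (delta u) = coef phi u.
Proof.
move=> le_u; rewrite /ev; under eq_bigr do rewrite sum_tuple_pred1.
rewrite (bigD1 (inord (size u))) //= inordK // eqxx mulr1 big1 ?addr0 // => n.
rewrite -val_eqE /= inordK // eq_sym => /negPf->; exact: mulr0.
Qed.

(** Cyclicity moves the factor of [B^{-1}] to the front, where it cancels against that of [B] by
    [conv_sig_rev] for the reversed path. *)
Lemma rot_invariant_conjugation : rot_invariant -> conjugation_invariant phi.
Proof.
move=> inv A B /piecewise_smooth_rectifiable rA /piecewise_smooth_rectifiable rB.
have rB' := rectifiable_rev rB.
rewrite -[LHS]/(ev (sig A)) -[RHS]/(ev (sig _)).
transitivity (ev (conv (conv (sig B) (sig A)) (sig (Defs.rev_path B)))); last first.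
  apply: eq_ev => w _; rewrite sig_concat //; last exact: rectifiable_concat.
  by apply: (@eq_conv _ _ _ _ _ _ (size w)) => // u _; rewrite sig_concat.
rewrite ev_convC //; apply: eq_ev => w _; rewrite convA -conv_delta_nil.
apply: (@eq_conv _ _ _ _ _ _ (size w)) => // u _.
by have := conv_sig_rev u rB'; rewrite rev_pathK.
Qed.

(** The linear span of signatures modulo words longer than [N]. The last constructor builds in the
    truncation, through which single letters enter. *)
Inductive sig_span N : (seq 'I_d -> R) -> Prop :=
| sig_span0 : sig_span N (fun=> 0)
| sig_span_sig X : piecewise_smooth X -> sig_span N (sig X)
| sig_spanD f g : sig_span N f -> sig_span N g -> sig_span N (fun w => f w + g w)
| sig_spanZ a f : sig_span N f -> sig_span N (fun w => a * f w)
| sig_span_eq f g : (forall w, (size w <= N)%N -> f w = g w) ->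
    sig_span N f -> sig_span N g.

Lemma sig_span_sum N n (F : 'I_n -> seq 'I_d -> R) :
  (forall k, sig_span N (F k)) -> sig_span N (fun w => \sum_k F k w).
Proof.
elim: n F => [|n IHn] F spF.
  by apply: sig_span_eq (sig_span0 N) => w _; rewrite big_ord0.
apply: (@sig_span_eq _ (fun w => F ord0 w + \sum_k F (lift ord0 k) w)).
  by move=> w _; rewrite big_ord_recl.
by apply: sig_spanD => //; apply: IHn.
Qed.

(** By bilinearity it suffices to treat two signatures, whose product is the signature of the
    concatenation. *)
Lemma sig_span_conv N f g : sig_span N f -> sig_span N g -> sig_span N (conv f g).
Proof.
move=> spf spg; elim: spf => {f}.
- by apply: sig_span_eq (sig_span0 N) => w _; rewrite conv0l.
- move=> X sX; elim: spg => {g}.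
  + by apply: sig_span_eq (sig_span0 N) => w _; rewrite conv0r.
  + move=> Y sY; apply: sig_span_eq (sig_span_sig N (piecewise_smooth_concat sX sY)).
    by move=> w _; rewrite sig_concat //; apply: piecewise_smooth_rectifiable.
  + move=> f g _ spf _ spg; apply: sig_span_eq (sig_spanD spf spg) => w _.
    by rewrite convDr.
  + move=> a f _ spf; apply: sig_span_eq (sig_spanZ a spf) => w _.
    by rewrite convZr.
  + move=> f g fg _; apply: sig_span_eq => w; apply: eq_conv => //.
- move=> f1 f2 _ sp1 _ sp2; apply: sig_span_eq (sig_spanD sp1 sp2) => w _.
  by rewrite convDl.
- move=> a f _ spf; apply: sig_span_eq (sig_spanZ a spf) => w _.
  by rewrite convZl.
- by move=> f1 f2 f12 _; apply: sig_span_eq => w; apply: eq_conv.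
Qed.

(** The nodes 0, ..., [N] are distinct, so the Vandermonde matrix is invertible. The resulting
    functional reads off the linear coefficient of a polynomial of degree at most [N]. *)
Lemma vandermonde_coefficients N : exists c : 'I_N.+1 -> R,
  forall j, (j <= N)%N -> \sum_k c k * k%:R ^+ j = (j == 1)%:R.
Proof.
pose V : 'M[R]_N.+1 := Vandermonde N.+1 (\row_k k%:R).
have uV : V \in unitmx.
  rewrite unitmxE det_Vandermonde unitfE; apply/prodf_neq0 => i _.
  apply/prodf_neq0 => j ltij; rewrite !mxE subr_eq0 eqr_nat.
  by rewrite neq_ltn ltij orbT.
pose e : 'cV[R]_N.+1 := \col_j (j == 1 :> nat)%:R.
exists (fun k => (invmx V *m e) k 0) => j le_jN.
have := congr1 (fun M : 'cV[R]_N.+1 => M (inord j) 0) (mulKVmx uV e).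
rewrite !mxE inordK // => <-; apply: eq_bigr => k _.
by rewrite !mxE inordK // mulrC.
Qed.

(* exp(k e_i) for k = 0, ..., N determines e_i modulo words longer than N. *)
Lemma sig_span_letter N i : sig_span N (delta [:: i]).
Proof.
have [c cV] := vandermonde_coefficients N.
pose F k w := c k * sig (axis_path i k%:R) w.
apply: (@sig_span_eq _ (fun w => \sum_k F k w)); last first.
  by apply: sig_span_sum => k; apply/sig_spanZ/sig_span_sig/piecewise_smooth_axis.
move=> w le_wN; under eq_bigr do rewrite /F sig_axis !mulrA.
rewrite -!mulr_suml cV //; rewrite /delta; case: w {le_wN} => [|x [|y w]].
- by rewrite !mul0r.
- by rewrite eqseq_cons /= !andbT !mul1r invr1 mul1r.
- by rewrite eqseq_cons andbF !mul0r.
Qed.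

Lemma sig_span_delta N x u : sig_span N (delta (x :: u)).
Proof.
elim: u x => [|y u IHu] x; first exact: sig_span_letter.
apply: sig_span_eq (sig_span_conv (sig_span_letter N x) (IHu y)) => w _.
by rewrite conv_delta.
Qed.

(** Conjugating [A ⊔ B] by [B] gives the signature S(B) S(A) S(B) S(B^{-1}) = S(B) S(A). *)
Lemma conjugation_ev_convC A B : conjugation_invariant phi ->
  piecewise_smooth A -> piecewise_smooth B ->
  ev (conv (sig A) (sig B)) = ev (conv (sig B) (sig A)).
Proof.
move=> inv sA sB.
have [rA rB] := (piecewise_smooth_rectifiable sA, piecewise_smooth_rectifiable sB).
have rB' := rectifiable_rev rB; have rAB := rectifiable_concat rA rB.
have rBAB := rectifiable_concat rB rAB.
transitivity (ev (sig (concat_path A B))).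
  by apply: eq_ev => w _; rewrite sig_concat.
rewrite -[LHS]/(pairing _ phi) (inv _ _ (piecewise_smooth_concat sA sB) sB).
apply: eq_ev => w _; rewrite sig_concat //.
transitivity (conv (conv (conv (sig B) (sig A)) (sig B)) (sig (Defs.rev_path B)) w).
  apply: (@eq_conv _ _ _ _ _ _ (size w)) => // u _; rewrite sig_concat // -convA.
  by apply: (@eq_conv _ _ _ _ _ _ (size u)) => // v _; rewrite sig_concat.
rewrite -convA -[RHS]conv_nil_delta.
by apply: (@eq_conv _ _ _ _ _ _ (size w)) => // u _; rewrite conv_sig_rev.
Qed.

(** Bilinear extension of the case of two signatures; words longer than [deg phi] do not affect
    [ev]. *)
Lemma sig_span_ev_convC f g : conjugation_invariant phi ->
  sig_span (deg phi) f -> sig_span (deg phi) g -> ev (conv f g) = ev (conv g f).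
Proof.
move=> inv spf spg.
elim: spf => {f}.
- by apply: eq_ev => w _; rewrite conv0l conv0r.
- move=> X sX; elim: spg => {g}.
  + by apply: eq_ev => w _; rewrite conv0l conv0r.
  + by move=> Y sY; apply: conjugation_ev_convC.
  + move=> f g _ IHf _ IHg.
    rewrite (eq_ev (fun w _ => convDr (sig X) f g w)) evD IHf IHg -evD.
    by apply: eq_ev => w _; rewrite convDl.
  + move=> a f _ IHf.
    rewrite (eq_ev (fun w _ => convZr a (sig X) f w)) evZ IHf -evZ.
    by apply: eq_ev => w _; rewrite convZl.
  + move=> f g fg _ IHf; transitivity (ev (conv (sig X) f)).
      by apply: eq_ev => w; apply: eq_conv => // u /fg.
    by rewrite IHf; apply: eq_ev => w; apply: eq_conv => // u /fg.
- move=> f1 f2 _ IHf _ IHg.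
  rewrite (eq_ev (fun w _ => convDl f1 f2 g w)) evD IHf IHg -evD.
  by apply: eq_ev => w _; rewrite convDr.
- move=> a f _ IHf.
  rewrite (eq_ev (fun w _ => convZl a f g w)) evZ IHf -evZ.
  by apply: eq_ev => w _; rewrite convZr.
- move=> f1 f2 f12 _ IHf; transitivity (ev (conv f1 g)).
    by apply: eq_ev => w; apply: eq_conv => // u /f12.
  by rewrite IHf; apply: eq_ev => w; apply: eq_conv => // u /f12.
Qed.

Lemma conjugation_rot_invariant : conjugation_invariant phi -> rot_invariant.
Proof.
move=> inv w; have [lt_w|le_w] := ltnP (deg phi) (size w).
  by rewrite !coefP ?size_rot.
(* Words of length at most one are fixed by rotation. Otherwise [w] is the product of [x] and
   [y :: u], and its rotation is their product in the other order. *)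
case: w le_w => [|x [|y u]] // le_w.
rewrite -[LHS]ev_delta ?size_rot // -[RHS]ev_delta // rot1_cons -cats1.
have := sig_span_ev_convC inv (sig_span_delta (deg phi) y u)
                              (sig_span_letter (deg phi) x).
by rewrite !(eq_ev (fun w _ => conv_delta _ _ w)).
Qed.

(** * Shifts and the span of rotations *)

Lemma shift_pi_coefE m w : shift_pi_coef m phi w =
  coef phi (rot 1 w) * (size w == m)%:R.
Proof.
rewrite -(size_rot 1 w) -sum_tuple_pred1; apply: eq_bigr => t _.
(* The shift sends a word to [w] exactly when that word is [rot 1 w]. *)
by rewrite /shift_word (can2_eq (rotrK 1) (rotK 1)).
Qed.

Lemma rot_invariant_shift : rot_invariant <-> shift_invariant phi.
Proof.
split=> [inv m w <-|inv w]; first by rewrite shift_pi_coefE eqxx mulr1 inv.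
by rewrite (inv (size w) w) // shift_pi_coefE eqxx mulr1.
Qed.

Lemma rot_coefE v w :
  rot_coef v w = \sum_(k < maxn 1 (size v)) (rot k v == w)%:R.
Proof.
rewrite /rot_coef -sum1_count natr_sum big_mkcond /=.
rewrite -(big_mkord xpredT (fun k => (rot k v == w)%:R : R)) /index_iota subn0.
by apply: eq_bigr => k _; case: eqP.
Qed.

Lemma rot_coef_rot v w : rot_coef v (rot 1 w) = rot_coef v w.
Proof.
rewrite !rot_coefE; case: v => [|x v].
  apply: eq_bigr => k _; rewrite rot_oversize //.
  by rewrite -(inj_eq (@rot_inj 1 _) _ w).
have -> : maxn 1 (size (x :: v)) = (size v).+1 by apply/maxn_idPr.
(* Term [k + 1] for [rot 1 w] matches term [k] for [w]; the remaining term 0 matches the last one,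
   because a full rotation returns [x :: v]. *)
rewrite big_ord_recl big_ord_recr addrC /=.
congr (_ + _).
  apply: eq_bigr => k _; rewrite -(inj_eq (@rot_inj 1 _) _ w) -rotS //=.
  exact: leqW.
by rewrite -(inj_eq (@rot_inj 1 _) _ w) -rotS // (rot_size (x :: v)) rot0.
Qed.

Lemma rot_span_rot_invariant : in_rot_span phi -> rot_invariant.
Proof.
move=> [s cs] w; rewrite !cs; apply: eq_bigr => p _.
by rewrite rot_coef_rot.
Qed.

(* phi is the sum over words v of (coef phi v / |v|) rot v. *)
Lemma rot_invariant_rot_span : rot_invariant -> in_rot_span phi.
Proof.
move=> inv.
(* [maxn 1 n] is the number of rotations that [rot_coef] counts, with 1 for the empty word. *)
exists (flatten [seq [seq (coef phi t / (maxn 1 n)%:R, tval t) |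
                        t : n.-tuple 'I_d] | n <- seq.iota 0 (deg phi).+1]) => w.
rewrite big_flatten big_map.
have block n : \sum_(p <- [seq (coef phi t / (maxn 1 n)%:R, tval t) | t : n.-tuple 'I_d])
    p.1 * rot_coef p.2 w = coef phi w * (size w == n)%:R.
  rewrite big_image /=.
  under eq_bigr => t _ do rewrite rot_coefE size_tuple mulr_sumr.
  rewrite exchange_big /=.
  (* Each rotation contributes equally, since tuples can be reindexed by it and [coef phi] is
     unchanged. *)
  transitivity (\sum_(k < maxn 1 n) coef phi w * (size w == n)%:R / (maxn 1 n)%:R).
    apply: eq_bigr => k _.
    rewrite -sum_tuple_pred1 mulr_suml.
    rewrite -(@sum_tuple_rot _ k (fun u => coef phi u * (u == w)%:R / (maxn 1 n)%:R)).
    by apply: eq_bigr => t _; rewrite coef_rot // mulrAC.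
  rewrite sumr_const card_ord -[LHS]mulr_natr mulfVK //.
  by rewrite pnatr_eq0 -lt0n leq_max.
under eq_bigr do rewrite block.
rewrite -mulr_sumr; have [lt_w|le_w] := ltnP (deg phi) (size w).
  by rewrite coefP // mul0r.
rewrite (bigD1_seq (size w)) ?iota_uniq ?mem_iota //= eqxx big1 ?addr0 ?mulr1 // => n.
by rewrite eq_sym => /negPf->.
Qed.

End Pairing.

Theorem mainTheorem1 (d : nat) (phi : tensor d) :
  (conjugation_invariant phi <-> in_rot_span phi) /\
  (conjugation_invariant phi <-> shift_invariant phi).
Proof.
have conjP : conjugation_invariant phi <-> rot_invariant phi.
  by split; [apply: conjugation_rot_invariant | apply: rot_invariant_conjugation].
split; rewrite conjP; last exact: rot_invariant_shift.
by split; [apply: rot_invariant_rot_span | apply: rot_span_rot_invariant].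
Qed.
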